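(* (i) Any 2-dimensional real Lie triple algebra is isomorphic to one of the algebras of the following types, where $\{u,v\}$ denotes a basis and $\alpha,\beta,\gamma,a,b,e,f,k$ are real numbers: (T1) $u\cdot v=0$, $\langle u;u,v\rangle=\alpha u+\beta v$, $\langle v;u,v\rangle=\gamma u-\alpha v$; (T2) $u\cdot v=u$, $\langle u;u,v\rangle=0$, $\langle v;u,v\rangle=ku$; (T3) $u\cdot v=u+v$, $\langle u;u,v\rangle=0$, $\langle v;u,v\rangle=0$; (T4) $u\cdot v=au+bv$, $\langle u;u,v\rangle=eu+fv$, $\langle v;u,v\rangle=ku-ev$ (with $a\neq0$, $b\neq0$, $e\neq0$, $f\neq0$, $k\neq0$, $af-be=0=bk+ae$). (ii) Any 2-dimensional real Bol algebra is isomorphic to one of the algebras of the following types, where $\{u,v\}$ denotes a basis, $\alpha,\beta,\gamma$ are real numbers, and $c,d,e,f,k$ are real numbers with $c\neq0$, $d\neq0$, $e\neq0$, $f\neq0$, $k\neq0$: (B1) $u*v=0$, $\langle u;u,v\rangle=\alpha u+\beta v$, $\langle v;u,v\rangle=\gamma u-\alpha v$; (B2) $u*v=cu+dv$, $\langle u;u,v\rangle=eu+fv$, $\langle v;u,v\rangle=ku-ev$; (B3) $u*v=cu+dv$, $\langle u;u,v\rangle=eu+fv$, $\langle v;u,v\rangle=-ev$; (B4) $u*v=cu+dv$, $\langle u;u,v\rangle=eu$, $\langle v;u,v\rangle=ku-ev$; (B5) $u*v=cu+dv$, $\langle u;u,v\rangle=eu$, $\langle v;u,v\rangle=-ev$;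 (B6) $u*v=cu+dv$, $\langle u;u,v\rangle=fv$, $\langle v;u,v\rangle=ku$; (B7) $u*v=cu+dv$, $\langle u;u,v\rangle=fv$, $\langle v;u,v\rangle=0$; (B8) $u*v=cu+dv$, $\langle u;u,v\rangle=0$, $\langle v;u,v\rangle=0$; (B9) $u*v=cu$, $\langle u;u,v\rangle=eu+fv$, $\langle v;u,v\rangle=ku-ev$; (B10) $u*v=cu$, $\langle u;u,v\rangle=eu+fv$, $\langle v;u,v\rangle=-ev$; (B11) $u*v=cu$, $\langle u;u,v\rangle=eu$, $\langle v;u,v\rangle=ku-ev$; (B12) $u*v=cu$, $\langle u;u,v\rangle=eu$, $\langle v;u,v\rangle=-ev$; (B13) $u*v=cu$, $\langle u;u,v\rangle=fv$, $\langle v;u,v\rangle=ku$; (B14) $u*v=cu$, $\langle u;u,v\rangle=fv$, $\langle v;u,v\rangle=0$; (B15) $u*v=cu$, $\langle u;u,v\rangle=0$, $\langle v;u,v\rangle=ku$; (B16) $u*v=cu$, $\langle u;u,v\rangle=0$, $\langle v;u,v\rangle=0$; (B17) $u*v=dv$, $\langle u;u,v\rangle=eu+fv$, $\langle v;u,v\rangle=-ev$; (B18) $u*v=dv$, $\langle u;u,v\rangle=eu$, $\langle v;u,v\rangle=ku-ev$; (B19) $u*v=dv$, $\langle u;u,v\rangle=eu$, $\langle v;u,v\rangle=-ev$.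
   Context: All algebras are finite-dimensional over $\mathbb R$; binary operations are bilinear and skew-symmetric, ternary operations $\langle\,;\,,\,\rangle$ are trilinear and skew-symmetric in the last two variables, and $\sigma$ denotes the sum over cyclic permutations of $\xi,\eta,\zeta$. A Lie triple algebra (generalized Lie triple system) $(\mathcal V,\cdot,\langle\,;\,,\,\rangle)$ satisfies, for all elements of $\mathcal V$: $\sigma\{\xi\cdot(\eta\cdot\zeta)-\langle\xi;\eta,\zeta\rangle\}=0$; $\sigma\{\langle\theta;\zeta,\xi\cdot\eta\rangle\}=0$; $\kappa\cdot\langle\zeta;\xi,\eta\rangle-\zeta\cdot\langle\kappa;\xi,\eta\rangle+\langle\zeta\cdot\kappa;\xi,\eta\rangle=0$; $\langle\langle\chi;\xi,\eta\rangle;\zeta,\kappa\rangle-\langle\langle\chi;\zeta,\kappa\rangle;\xi,\eta\rangle+\langle\chi;\zeta,\langle\kappa;\xi,\eta\rangle\rangle-\langle\chi;\kappa,\langle\zeta;\xi,\eta\rangle\rangle=0$. A Bol algebra $(\mathcal V,*,\langle\,;\,,\,\rangle)$ satisfies, for all elements of $\mathcal V$: $\sigma\{\langle\xi;\eta,\zeta\rangle\}=0$; $\langle\xi*\eta;\zeta,\kappa\rangle-\langle\zeta*\kappa;\xi,\eta\rangle+\zeta*\langle\kappa;\xi,\eta\rangle-\kappa*\langle\zeta;\xi,\eta\rangle+(\xi*\eta)*(\zeta*\kappa)=0$; $\langle\langle\chi;\xi,\eta\rangle;\zeta,\kappa\rangle-\langle\langle\chi;\zeta,\kappa\rangle;\xi,\eta\rangle+\langle\chi;\zeta,\langle\kappa;\xi,\eta\rangle\rangle-\langle\chi;\kappa,\langle\zeta;\xi,\eta\rangle\rangle=0$.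 An isomorphism is a linear bijection preserving the operations. In dimension 2 with basis $\{u,v\}$, the operations are determined by the listed values through (multi)linearity and skew-symmetry. *)

(* Defs.v *)
(* The real field is rendered as an arbitrary [realType]. *)
From HB Require Import structures.
From mathcomp Require Import all_boot all_order all_algebra.
From mathcomp Require Import reals.
From mathcomp Require Import ring.

Set Implicit Arguments.
Unset Strict Implicit.
Unset Printing Implicit Defensive.

Import Order.TTheory GRing.Theory Num.Theory.
Local Open Scope ring_scope.

(* [tri x y z] is <x; y, z>, skew-symmetric in its last two arguments. *)
Record skewAlgebra (R : realType) := SkewAlgebra {
  carrier :> vectType R;
  mul : carrier -> carrier -> carrier;
  tri : carrier -> carrier -> carrier -> carrier;
  mul_linearl : forall y, linear (fun x => mul x y);
  mul_linearr : forall x, linear (fun y => mul x y);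
  mul_skew : forall x y, mul x y = - mul y x;
  tri_linear1 : forall y z, linear (fun x => tri x y z);
  tri_linear2 : forall x z, linear (fun y => tri x y z);
  tri_linear3 : forall x y, linear (fun z => tri x y z);
  tri_skew : forall x y z, tri x y z = - tri x z y
}.

Local Notation "x ⋅ y" := (mul x y) (at level 40, left associativity).
Local Notation "⟨ x ; y , z ⟩" := (tri x y z)
  (at level 0, x, y, z at level 99).

Definition cyclic_sum (V : zmodType) (F : V -> V -> V -> V) (x y z : V) : V :=
  F x y z + F y z x + F z x y.

(* The identity common to both classes: every ⟨-; x, y⟩ is a derivation of
   the ternary operation. *)
Definition ternary_identity (R : realType) (A : skewAlgebra R) : Prop :=
  forall w x y z k : A,
    ⟨⟨w; x, y⟩; z, k⟩ - ⟨⟨w; z, k⟩; x, y⟩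
      + ⟨w; z, ⟨k; x, y⟩⟩ - ⟨w; k, ⟨z; x, y⟩⟩ = 0.

Record lie_triple_algebra (R : realType) (A : skewAlgebra R) : Prop := {
  lta_jacobi : forall x y z : A,
    cyclic_sum (fun x y z => x ⋅ (y ⋅ z) - ⟨x; y, z⟩) x y z = 0;
  lta_cyclic : forall t x y z : A,
    cyclic_sum (fun x y z => ⟨t; z, x ⋅ y⟩) x y z = 0;
  lta_derivation : forall x y z k : A,
    k ⋅ ⟨z; x, y⟩ - z ⋅ ⟨k; x, y⟩ + ⟨z ⋅ k; x, y⟩ = 0;
  lta_ternary : ternary_identity A
}.

Record bol_algebra (R : realType) (A : skewAlgebra R) : Prop := {
  bol_cyclic : forall x y z : A,
    cyclic_sum (fun x y z => ⟨x; y, z⟩) x y z = 0;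
  bol_pseudo_derivation : forall x y z k : A,
    ⟨x ⋅ y; z, k⟩ - ⟨z ⋅ k; x, y⟩ + z ⋅ ⟨k; x, y⟩ - k ⋅ ⟨z; x, y⟩
      + (x ⋅ y) ⋅ (z ⋅ k) = 0;
  bol_ternary : ternary_identity A
}.

Definition isomorphic (R : realType) (A B : skewAlgebra R) : Prop :=
  exists f : {linear A -> B},
    [/\ bijective f,
        forall x y : A, f (x ⋅ y) = f x ⋅ f y &
        forall x y z : A, f ⟨x; y, z⟩ = ⟨f x; f y, f z⟩].

Section TwoDimensional.
Variables (R : realType) (w p q : 'rV[R]_2).
Implicit Types x y z : 'rV[R]_2.

Let det2 x y : R := x 0 0 * y 0 1 - x 0 1 * y 0 0.

Definition mul2 x y : 'rV[R]_2 := det2 x y *: w.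

Definition tri2 x y z : 'rV[R]_2 := det2 y z *: (x 0 0 *: p + x 0 1 *: q).

Fact mul2_linearl y : linear (fun x => mul2 x y).
Proof. by move=> a x x'; apply/rowP=> i; rewrite /mul2 /det2 !mxE; ring. Qed.

Fact mul2_linearr x : linear (fun y => mul2 x y).
Proof. by move=> a y y'; apply/rowP=> i; rewrite /mul2 /det2 !mxE; ring. Qed.

Fact mul2_skew x y : mul2 x y = - mul2 y x.
Proof. by apply/rowP=> i; rewrite /mul2 /det2 !mxE; ring. Qed.

Fact tri2_linear1 y z : linear (fun x => tri2 x y z).
Proof. by move=> a x x'; apply/rowP=> i; rewrite /tri2 /det2 !mxE; ring. Qed.

Fact tri2_linear2 x z : linear (fun y => tri2 x y z).
Proof. by move=> a y y'; apply/rowP=> i; rewrite /tri2 /det2 !mxE; ring. Qed.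

Fact tri2_linear3 x y : linear (fun z => tri2 x y z).
Proof. by move=> a z z'; apply/rowP=> i; rewrite /tri2 /det2 !mxE; ring. Qed.

Fact tri2_skew x y z : tri2 x y z = - tri2 x z y.
Proof. by apply/rowP=> i; rewrite /tri2 /det2 !mxE; ring. Qed.

(* The algebra on R^2 whose operations are determined, for the standard basis
   u = (1, 0), v = (0, 1), by u ⋅ v = w, ⟨u; u, v⟩ = p and ⟨v; u, v⟩ = q;
   see [alg2E]. *)
Definition alg2 : skewAlgebra R :=
  SkewAlgebra mul2_linearl mul2_linearr mul2_skew
    tri2_linear1 tri2_linear2 tri2_linear3 tri2_skew.

Lemma alg2E (u : alg2 := delta_mx 0 0) (v : alg2 := delta_mx 0 1) :
  [/\ u ⋅ v = w, ⟨u; u, v⟩ = p & ⟨v; u, v⟩ = q].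
Proof.
by split; apply/rowP=> i; rewrite /= /mul2 /tri2 /det2 !mxE /=; ring.
Qed.

End TwoDimensional.

(* Main.v *)
Require Import Defs.
From HB Require Import structures.
From mathcomp Require Import all_boot all_order all_algebra.
From mathcomp Require Import reals.
From mathcomp Require Import ring.

Set Implicit Arguments.
Unset Strict Implicit.
Unset Printing Implicit Defensive.

Import Order.TTheory GRing.Theory Num.Theory.
Local Open Scope ring_scope.

(** In a plane an alternating bilinear map is a multiple of the determinant, so
    the two operations reduce to a vector w and an endomorphism M:
      x ⋅ y = det(x, y) w   and   ⟨x; y, z⟩ = det(y, z) M x.
    The ternary identity, common to both classes of algebras, then reads
    tr(M) M = 0, that is, tr M = 0 ([ternary_traceless]).  Once M has trace
    zero, the derivation identity of a Lie triple algebra becomes M w = 0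
    ([lie_triple_kernel]).

    It remains to choose a basis.  If w = 0, any basis gives the type with zero
    binary operation.  If w is nonzero, complete it to a basis (w, v) with
    det(w, v) = 1, so that w ⋅ v = w ([binary_normal_form]).  In the Lie triple
    case M w = 0 and tr M = 0 leave M v = k w.  In the Bol case
      M w = e w + f v   and   M v = k w - e v,
    and the eight patterns of vanishing among e, f, k are eight of the listed
    types, all with binary operation u * v = c u and here c = 1. *)

Local Notation "x ⋅ y" := (Defs.mul x y) (at level 40, left associativity).
Local Notation "⟨ x ; y , z ⟩" := (tri x y z)
  (at level 0, x, y, z at level 99).

(** * Alternating maps in a plane *)

Section Alternating.
Variables (R : numFieldType) (V W : lmodType R) (B : V -> V -> W).
Hypothesis Bl : forall y, linear (fun x => B x y).
Hypothesis Br : forall x, linear (B x).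
Hypothesis Bskew : forall x y, B x y = - B y x.

Lemma skew_diag x : B x x = 0.
Proof.
have : 2 *: B x x = 0 by rewrite scaler_nat mulr2n {1}Bskew addNr.
by move/eqP; rewrite scaler_eq0 pnatr_eq0 => /eqP.
Qed.

Lemma skew_scalel a x y : B (a *: x) y = a *: B x y.
Proof. exact: GRing.scalable_linear (Bl y) a x. Qed.

Lemma skew_det e f a b c d :
  B (a *: e + b *: f) (c *: e + d *: f) = (a * d - b * c) *: B e f.
Proof.
have scaler x t y : B x (t *: y) = t *: B x y.
  by rewrite Bskew skew_scalel -scalerN -Bskew.
rewrite Bl !Br !skew_scalel !scaler !skew_diag (Bskew f e).
by rewrite !scaler0 add0r addr0 !scalerN !scalerA scalerBl (mulrC c b).
Qed.

End Alternating.

Section SkewAlgebra.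
Variables (R : realType) (A : skewAlgebra R).
Implicit Types x y z e f : A.

Lemma mul_det e f (a b c d : R) :
  (a *: e + b *: f) ⋅ (c *: e + d *: f) = (a * d - b * c) *: (e ⋅ f).
Proof.
apply: (skew_det (B := @Defs.mul R A)); first exact: mul_linearl.
  exact: mul_linearr.
exact: mul_skew.
Qed.

Lemma tri_det x e f (a b c d : R) :
  ⟨x; a *: e + b *: f, c *: e + d *: f⟩ = (a * d - b * c) *: ⟨x; e, f⟩.
Proof.
apply: (skew_det (B := @tri R A x)); first exact: tri_linear2.
  exact: tri_linear3.
exact: tri_skew.
Qed.

Lemma tri_comb e f y z (a b : R) :
  ⟨a *: e + b *: f; y, z⟩ = a *: ⟨e; y, z⟩ + b *: ⟨f; y, z⟩.
Proof.
rewrite tri_linear1; congr (_ + _).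
exact: GRing.scalable_linear (tri_linear1 y z) b f.
Qed.

(** * Bases of a two-dimensional algebra *)

Lemma basis2_span e f x :
  basis_of fullv [:: e; f] -> exists a b : R, x = a *: e + b *: f.
Proof.
move=> Bef; have := coord_basis (X := [tuple e; f]) Bef (memvf x).
by rewrite !big_ord_recl big_ord0 addr0 => xE; do 2 eexists; exact: xE.
Qed.

Lemma basis2_eq0 e f (a b : R) :
  basis_of fullv [:: e; f] -> a *: e + b *: f = 0 -> a = 0 /\ b = 0.
Proof.
move=> /basis_free/(@freeP _ _ _ [tuple e; f]) fr E.
have := fr (fun i => if i == 0 then a else b).
rewrite !big_ord_recl big_ord0 addr0 /= => /(_ E) k0.
by split; [have := k0 0 | have := k0 1].
Qed.

Lemma dim2_basis : \dim {:A} = 2%N ->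
  exists e f : A, basis_of fullv [:: e; f].
Proof.
move=> dimA; have := vbasisP {:A}; have := size_tuple (vbasis {:A}).
case: (tval _) => [|e [|f [|? ?]]] /=; rewrite dimA // => _ bas.
by exists e, f.
Qed.

(** A product of dependent vectors vanishes. *)
Lemma mul_neq0_basis e f :
  \dim {:A} = 2%N -> e ⋅ f != 0 -> basis_of fullv [:: e; f].
Proof.
move=> dimA efN0; rewrite basisEfree subvf dimA !andbT free_cons seq1_free.
have dep c : (c *: f) ⋅ f = 0.
  rewrite (skew_scalel (@mul_linearl _ A)).
  by rewrite (skew_diag (@mul_skew _ A)) scaler0.
apply/andP; split.
  rewrite span_seq1; apply: contraNN efN0 => /vlineP [c ->].
  by rewrite dep.
apply: contraNneq efN0 => ->.
rewrite mul_skew -[X in X ⋅ _](scale0r e).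
by rewrite (skew_scalel (@mul_linearl _ A)) scale0r oppr0.
Qed.

(** The new first vector is w = e ⋅ f itself; since [w ⋅ x] is det(w, x) w, a
    partner of w is a vector x with det(w, x) = 1, a multiple of f or of e. *)
Lemma binary_normal_form : \dim {:A} = 2%N ->
  exists e f : A, basis_of fullv [:: e; f] /\ (e ⋅ f = 0 \/ e ⋅ f = e).
Proof.
move=> dimA; have [e [f bas]] := dim2_basis dimA.
have [ef0|efN0] := eqVneq (e ⋅ f) 0; first by exists e, f; split; last left.
suff [x wx] : exists x, (e ⋅ f) ⋅ x = e ⋅ f.
  exists (e ⋅ f), x; split; last by right.
  by apply: mul_neq0_basis => //; rewrite wx.
have [a [b wE]] := basis2_span (e ⋅ f) bas.
have [a0|aN0] := eqVneq a 0; last first.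
  exists (0 *: e + a^-1 *: f).
  by rewrite {1}wE mul_det mulfV // mulr0 subr0 scale1r.
have bN0 : b != 0.
  by apply: contraNneq efN0 => b0; rewrite wE a0 b0 !scale0r addr0.
exists (- b^-1 *: e + 0 *: f).
by rewrite {1}wE mul_det a0 mul0r mulrN mulfV // opprK add0r scale1r.
Qed.

(** At (x; e, f, e, f) the two nested brackets cancel, because M commutes with
    itself, and the other two terms add up to tr(M) M x. *)
Lemma ternary_traceless e f (al be ga de : R) :
  basis_of fullv [:: e; f] -> ternary_identity A ->
  ⟨e; e, f⟩ = al *: e + be *: f -> ⟨f; e, f⟩ = ga *: e + de *: f ->
  de = - al.
Proof.
move=> bas ter eE fE.
have eC : e = 1 *: e + 0 *: f by rewrite scale1r scale0r addr0.
have fC : f = 0 *: e + 1 *: f by rewrite scale1r scale0r add0r.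
have trM x : (al + de) *: ⟨x; e, f⟩ = 0.
  have xeMf : ⟨x; e, ⟨f; e, f⟩⟩ = de *: ⟨x; e, f⟩.
    by rewrite fE {1}eC tri_det; congr (_ *: _); ring.
  have xfMe : ⟨x; f, ⟨e; e, f⟩⟩ = - al *: ⟨x; e, f⟩.
    by rewrite eE {1}fC tri_det; congr (_ *: _); ring.
  have := ter x e f e f.
  by rewrite xeMf xfMe subrr add0r -scalerBl opprK addrC.
apply/eqP; rewrite -addr_eq0 addrC; apply/negPn/negP => trN0.
have M0 x : ⟨x; e, f⟩ = 0.
  by have /eqP := trM x; rewrite scaler_eq0 (negPf trN0) => /eqP.
have [al0 _] := basis2_eq0 bas (etrans (esym eE) (M0 e)).
have [_ de0] := basis2_eq0 bas (etrans (esym fE) (M0 f)).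
by rewrite al0 de0 addr0 eqxx in trN0.
Qed.

Lemma ternary_normal_form : \dim {:A} = 2%N -> ternary_identity A ->
  exists (e f : A) (al be ga : R),
    [/\ basis_of fullv [:: e; f], e ⋅ f = 0 \/ e ⋅ f = e,
        ⟨e; e, f⟩ = al *: e + be *: f & ⟨f; e, f⟩ = ga *: e - al *: f].
Proof.
move=> dimA ter; have [e [f [bas efE]]] := binary_normal_form dimA.
have [al [be eE]] := basis2_span ⟨e; e, f⟩ bas.
have [ga [de fE]] := basis2_span ⟨f; e, f⟩ bas.
exists e, f, al, be, ga; split=> //.
by rewrite fE (ternary_traceless bas ter eE fE) scaleNr.
Qed.

(** For M traceless, the derivation identity at (e, f, e, f) is M (e ⋅ f) = 0. *)
Lemma lie_triple_kernel e f :
  basis_of fullv [:: e; f] -> lie_triple_algebra A ->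
  ⟨e ⋅ f; e, f⟩ = 0.
Proof.
move=> bas lta.
have [al [be eE]] := basis2_span ⟨e; e, f⟩ bas.
have [ga [de fE]] := basis2_span ⟨f; e, f⟩ bas.
have deE := ternary_traceless bas (lta_ternary lta) eE fE.
have eC : e = 1 *: e + 0 *: f by rewrite scale1r scale0r addr0.
have fC : f = 0 *: e + 1 *: f by rewrite scale1r scale0r add0r.
have fMe : f ⋅ ⟨e; e, f⟩ = - al *: (e ⋅ f).
  by rewrite eE {1}fC mul_det; congr (_ *: _); ring.
have eMf : e ⋅ ⟨f; e, f⟩ = de *: (e ⋅ f).
  by rewrite fE {1}eC mul_det; congr (_ *: _); ring.
have := lta_derivation lta e f e f.
by rewrite fMe eMf deE subrr add0r.
Qed.

(** * Algebras in coordinates *)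

Definition of_coords e f (r : 'rV[R]_2) : A := r 0 0 *: e + r 0 1 *: f.

Lemma of_coordsE e f (a b : R) :
  of_coords e f (a *: delta_mx 0 0 + b *: delta_mx 0 1) = a *: e + b *: f.
Proof. by rewrite /of_coords !mxE /= !mulr1 !mulr0 addr0 add0r. Qed.

(** The coordinate map in the basis (e, f) is an isomorphism as soon as it
    matches the three products that determine the operations. *)
Lemma isomorphic_alg2 e f (w p q : 'rV[R]_2) :
  basis_of fullv [:: e; f] -> e ⋅ f = of_coords e f w ->
  ⟨e; e, f⟩ = of_coords e f p -> ⟨f; e, f⟩ = of_coords e f q ->
  isomorphic A (alg2 w p q).
Proof.
move=> bas efE eE fE; pose g := of_coords e f.
pose h (x : A) : 'rV[R]_2 := \row_i coord [tuple e; f] i x.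
have h_lin : linear h by move=> a x y; apply/rowP=> i; rewrite !mxE linearP.
have hK : cancel h g.
  move=> x; rewrite [RHS](coord_basis (X := [tuple e; f]) bas (memvf x)).
  rewrite !big_ord_recl big_ord0 addr0 /g /of_coords !mxE.
  by have -> : lift ord0 ord0 = 1 :> 'I_2 by exact: val_inj.
have g_lin : linear g.
  move=> a x y; rewrite /g /of_coords !mxE !scalerDl scalerDr !scalerA.
  by rewrite addrACA.
have gZ a r : g (a *: r) = a *: g r by exact: GRing.scalable_linear g_lin a r.
pose gL : {linear 'rV[R]_2 -> A} :=
  HB.pack g (GRing.isLinear.Build _ _ _ _ g g_lin).
have g_inj : injective g.
  apply: (raddf_inj (f := gL)) => r /(basis2_eq0 bas) [r0 r1].
  apply/rowP=> i; rewrite mxE; case: i => [[|[|//]] Hi].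
    by rewrite -[RHS]r0; congr (r _ _); exact: val_inj.
  by rewrite -[RHS]r1; congr (r _ _); exact: val_inj.
have gK : cancel g h by move=> r; apply: g_inj; rewrite hK.
pose hL : {linear A -> alg2 w p q} :=
  HB.pack h (GRing.isLinear.Build _ _ _ _ (h : A -> alg2 w p q) h_lin).
(* After applying the injective g, both sides of each identity are products
   expanded over the basis (e, f). *)
exists hL; split; first by exists g.
  move=> x y; apply: g_inj; rewrite hK -{1}(hK x) -{1}(hK y).
  by rewrite mul_det efE -gZ.
move=> x y z; apply: g_inj; rewrite hK -{1}(hK x) -{1}(hK y) -{1}(hK z).
by rewrite tri_det tri_comb eE fE -/g -(gZ _ q) -g_lin -gZ.
Qed.

End SkewAlgebra.

(** * Classification *)

Theorem corollary2 (R : realType) :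
  let u : 'rV[R]_2 := delta_mx 0 0 in
  let v : 'rV[R]_2 := delta_mx 0 1 in
  (forall A : skewAlgebra R, \dim {:A} = 2%N -> lie_triple_algebra A ->
       (exists al be ga : R,
          isomorphic A (alg2 0 (al *: u + be *: v) (ga *: u - al *: v)))
    \/ (exists k : R, isomorphic A (alg2 u 0 (k *: u)))
    \/ isomorphic A (alg2 (u + v) 0 0)
    \/ (exists a b e f k : R,
          [/\ a != 0, b != 0, e != 0, f != 0 & k != 0] /\
          [/\ a * f - b * e = 0, b * k + a * e = 0 &
              isomorphic A (alg2 (a *: u + b *: v) (e *: u + f *: v)
                                 (k *: u - e *: v))]))
  /\
  (forall A : skewAlgebra R, \dim {:A} = 2%N -> bol_algebra A ->
       (exists al be ga : R,
          isomorphic A (alg2 0 (al *: u + be *: v) (ga *: u - al *: v)))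
    \/ (exists c d e f k : R,
          [/\ c != 0, d != 0, e != 0, f != 0 & k != 0] /\
          (  isomorphic A (alg2 (c *: u + d *: v)
                                (e *: u + f *: v) (k *: u - e *: v))
          \/ isomorphic A (alg2 (c *: u + d *: v)
                                (e *: u + f *: v) (- (e *: v)))
          \/ isomorphic A (alg2 (c *: u + d *: v)
                                (e *: u) (k *: u - e *: v))
          \/ isomorphic A (alg2 (c *: u + d *: v) (e *: u) (- (e *: v)))
          \/ isomorphic A (alg2 (c *: u + d *: v) (f *: v) (k *: u))
          \/ isomorphic A (alg2 (c *: u + d *: v) (f *: v) 0)
          \/ isomorphic A (alg2 (c *: u + d *: v) 0 0)
          \/ isomorphic A (alg2 (c *: u) (e *: u + f *: v) (k *: u - e *: v))
          \/ isomorphic A (alg2 (c *: u) (e *: u + f *: v) (- (e *: v)))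
          \/ isomorphic A (alg2 (c *: u) (e *: u) (k *: u - e *: v))
          \/ isomorphic A (alg2 (c *: u) (e *: u) (- (e *: v)))
          \/ isomorphic A (alg2 (c *: u) (f *: v) (k *: u))
          \/ isomorphic A (alg2 (c *: u) (f *: v) 0)
          \/ isomorphic A (alg2 (c *: u) 0 (k *: u))
          \/ isomorphic A (alg2 (c *: u) 0 0)
          \/ isomorphic A (alg2 (d *: v) (e *: u + f *: v) (- (e *: v)))
          \/ isomorphic A (alg2 (d *: v) (e *: u) (k *: u - e *: v))
          \/ isomorphic A (alg2 (d *: v) (e *: u) (- (e *: v)))))).
Proof.
move=> u v.
have uC : u = 1 *: u + 0 *: v by rewrite scale1r scale0r addr0.
have C0 : 0 = 0 *: u + 0 *: v by rewrite !scale0r addr0.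
split=> A dimA alg.
  have [e [f [al [be [ga [bas efE eE fE]]]]]] :=
    ternary_normal_form dimA (lta_ternary alg).
  case: efE => efE.
    left; exists al, be, ga; apply: (isomorphic_alg2 bas).
    - by rewrite C0 of_coordsE !scale0r addr0.
    - by rewrite of_coordsE.
    - by rewrite -scaleNr of_coordsE scaleNr.
  have Me0 : ⟨e; e, f⟩ = 0 by rewrite -{1}efE lie_triple_kernel.
  have [al0 _] := basis2_eq0 bas (etrans (esym eE) Me0).
  right; left; exists ga; apply: (isomorphic_alg2 bas).
  - by rewrite uC of_coordsE scale1r scale0r addr0.
  - by rewrite C0 of_coordsE !scale0r addr0.
  - by rewrite -[ga *: u]addr0 -(scale0r v) of_coordsE fE al0 !scale0r oppr0.
have [e [f [al [be [ga [bas efE eE fE]]]]]] :=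
  ternary_normal_form dimA (bol_ternary alg).
case: efE => efE.
  left; exists al, be, ga; apply: (isomorphic_alg2 bas).
  - by rewrite C0 of_coordsE !scale0r addr0.
  - by rewrite of_coordsE.
  - by rewrite -scaleNr of_coordsE scaleNr.
have iso : isomorphic A (alg2 (1 *: u) (al *: u + be *: v) (ga *: u - al *: v)).
  apply: (isomorphic_alg2 bas).
  - by rewrite -[1 *: u]addr0 -(scale0r v) of_coordsE scale1r scale0r addr0.
  - by rewrite of_coordsE.
  - by rewrite -scaleNr of_coordsE scaleNr.
(* A coefficient that vanishes does not occur in the type of the algebra, and
   1 stands for it in the list of nonzero parameters. *)
pose nz (x : R) := if x == 0 then 1 else x.
have nzN0 x : nz x != 0.
  by rewrite /nz; case: (eqVneq x 0) => [_|//]; exact: oner_neq0.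
right; exists 1, 1, (nz al), (nz be), (nz ga).
split; first by split; rewrite ?nzN0 ?oner_neq0.
(* The first seven alternatives have a v-component in the binary product. *)
do 7 right; move: iso; rewrite /nz.
case: (eqVneq al 0) => [->|_]; case: (eqVneq be 0) => [->|_];
  case: (eqVneq ga 0) => [->|_]; rewrite ?scale0r ?oppr0 ?addr0 ?add0r; tauto.
Qed.
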